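(* Let $\Omega$ be a domain in $\mathbb{C}$ and let $f\colon \Omega \to \mathbb{C}$ be a continuous, open and discrete map. Then the branch set $B_f$ is a discrete set.
   Context: A domain is a non-empty connected open set. A map $f\colon X\to Y$ between topological spaces is open if the image of each open set is open. A continuous map $f\colon X\to Y$ is discrete if for each $y \in Y$ the pre-image $f^{-1}(y)$ is a discrete subset of $X$. The branch set $B_f$ of a continuous map $f\colon X\to Y$ is the set of points $x\in X$ at which $f$ fails to be a local homeomorphism. *)

(* Defs.v *)
From mathcomp Require Import all_boot all_order all_algebra.
From mathcomp Require Import all_classical all_reals all_analysis.
From mathcomp.real_closed Require Import complex.

Set Implicit Arguments.
Unset Strict Implicit.
Unset Printing Implicit Defensive.

Import numFieldNormedType.Exports.
Local Open Scope classical_set_scope.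
Local Open Scope complex_scope.

(* The regular-module alias [^o] is what carries the topology of the complex
   modulus: the bare type [R[i]] has no topological structure of its own. *)
Notation Cplx R := ((R[i])^o) (only parsing).

Section topological_notions.
Context {X Y : topologicalType}.
Implicit Types (A : set X) (f : X -> Y) (x : X).

Definition domain A : Prop := [/\ A !=set0, connected A & open A].

Definition open_map f : Prop := forall U : set X, open U -> open (f @` U).

Definition discrete_set A : Prop := forall x, A x -> isolated A x.

Definition discrete_map f : Prop := forall y : Y, discrete_set (f @^-1` [set y]).

(* [f] restricts to a homeomorphism from an open neighbourhood [U] of [x] onto
   an open subset of [Y]; [g] is the inverse of that restriction. *)
Definition local_homeo_at f x : Prop :=
  exists U : set X, [/\ open U, U x, open (f @` U) &
    exists g : Y -> X, [/\ {within U, continuous f},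
      {within f @` U, continuous g} & {in U, cancel f g}]].

Definition branch_set f : set X := [set x | ~ local_homeo_at f x].

End topological_notions.

(* Main.v *)
(* Let x0 be a point of Omega with y0 = f x0, and suppose that f is not injective
   near a point x <> x0 close to x0. Then there are x1 <> x2 near x with
   f x1 = f x2 = z, and z can be chosen off the line through y0 and f x. As x0 is
   the only point over y0 in a small ball around it, the part E over the segment
   [y0, z] in that ball is a continuum: each clopen piece of it has a clopen image
   in the segment, hence contains x0. In the same way the part E' over [z, f x]
   in a small ball around x is a continuum. Their intersection lies in the
   discrete fibre of z and contains x1 and x2, so it is disconnected. By a theorem
   of Janiszewski there is a bounded open W, disjoint from E and E', whose boundary
   lies in their union. Then f(W) is open and bounded with boundary in
   [y0, z] `|` [z, f x], which is star-shaped about z; hence f(W) lies in this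
   union, even in [z, f x] since W avoids E, although it is open.

   Janiszewski's theorem is obtained by a parity argument on fine square grids: a
   mod 2 cochain counts the edges near E that separate the two pieces of
   E `&` E'; if the complement of the union had no bounded part, its coboundary
   could be moved off to infinity without changing it near the two continua, and
   a primitive would be constant on E' but would jump between the pieces along
   E. *)
Require Import Defs.
From mathcomp Require Import all_boot all_order all_algebra.
From mathcomp Require Import all_classical all_reals all_analysis.
From mathcomp.real_closed Require Import complex.
From mathcomp Require Import lra ring zify.
Import numFieldNormedType.Exports.

Set Implicit Arguments.
Unset Strict Implicit.
Unset Printing Implicit Defensive.

Import Order.TTheory GRing.Theory Num.Theory.
Local Open Scope classical_set_scope.
Local Open Scope ring_scope.

(** * Cochains modulo 2 on the integer grid *)

(** Modulo 2 a sum taken backwards from 0 needs no sign. *)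
Definition int_primitive (g : int -> bool) (i : int) : bool :=
  match i with
  | Posz n => \big[addb/false]_(k < n) g k
  | Negz n => \big[addb/false]_(k < n.+1) g (Negz k)
  end.

Lemma int_primitiveS g i :
  int_primitive g (i + 1) = int_primitive g i (+) g i.
Proof.
case: i => [n|[|n]].
- by rewrite -PoszD addn1 /= big_ord_recr.
- by rewrite /= big_ord_recr !big_ord0 /=; case: (g _).
- have -> : Negz n.+1 + 1 = Negz n by lia.
  by rewrite /= [in RHS]big_ord_recr /= -addbA addbb addbF.
Qed.

(* [h i j] is the value on the edge from [(i, j)] to [(i + 1, j)] and [v i j] the
   one on the edge to [(i, j + 1)]; the square [(i, j)] has lower left corner
   [(i, j)]. *)
Definition cobound (h v : int -> int -> bool) (i j : int) : bool :=
  (h i j (+) h i (j + 1)) (+) (v i j (+) v (i + 1) j).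

(** Poincaré lemma: integrate [h] along row 0 and [v] up the columns; the vanishing coboundary
    carries the identity for [h] from row to row, in both directions. *)
Lemma closed_cochain_exact h v : (forall i j, cobound h v i j = false) ->
  exists b : int -> int -> bool, forall i j,
    b (i + 1) j = b i j (+) h i j /\ b i (j + 1) = b i j (+) v i j.
Proof.
move=> hv0.
pose V i := int_primitive (v i).
pose b i j := int_primitive (h^~ 0) i (+) (V i j (+) V i 0).
have bv i j : b i (j + 1) = b i j (+) v i j.
  by rewrite /b /V int_primitiveS -!addbA [v i j (+) _]addbC.
exists b => i j; split=> //.
have step k : (b (i + 1) k == b i k (+) h i k) =
              (b (i + 1) (k + 1) == b i (k + 1) (+) h i (k + 1)).
  move: (hv0 i k); rewrite /cobound !bv.
  by do 2!case: (b _ _); case: (h i k); case: (h i (k + 1));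
    case: (v i k); case: (v (i + 1) k).
apply/eqP; elim/int_rect: j => [|n IH|n IH].
- by rewrite /b int_primitiveS !addbb !addbF.
- by rewrite -addn1 PoszD -step.
- by rewrite step (_ : - n.+1%:Z + 1 = - n%:Z) //; lia.
Qed.

Section fillable.
Variable far : int -> int -> Prop.

Definition far_cochain (h : int -> int -> bool) := forall i j, h i j -> far i j.

(* Crossing a far edge preserves fillability, and so does going out to infinity:
   the squares that are not fillable are enclosed by edges that are not far. *)
Definition fillable (s : int * int) : Prop := exists h v,
  [/\ far_cochain h, far_cochain v & forall i j, cobound h v i j = ((i, j) == s)].

(** The vertical edges crossed by the ray going right from the square form a cochain whose
    coboundary is that square alone. *)
Lemma fillable_right i j : (forall k, i < k -> far k j) -> fillable (i, j).
Proof.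
move=> fr; exists (fun _ _ => false), (fun k l => (l == j) && (i < k)).
split=> // [k l /andP[/eqP-> /fr//]|k l].
by rewrite /cobound xpair_eqE; case: (l == j); lia.
Qed.

Lemma fillable_left i j : (forall k, k <= i -> far k j) -> fillable (i, j).
Proof.
move=> fr; exists (fun _ _ => false), (fun k l => (l == j) && (k <= i)).
split=> // [k l /andP[/eqP-> /fr//]|k l].
by rewrite /cobound xpair_eqE; case: (l == j); lia.
Qed.

(** The edge between the two squares has exactly these squares as its coboundary, so adding it to a
    filling moves the filled square across. *)
Lemma fillable_h i j : far (i + 1) j -> fillable (i, j) <-> fillable (i + 1, j).
Proof.
move=> fij; split=> -[h [v [fh fv hvE]]];
  exists h, (fun k l => v k l (+) ((k, l) == (i + 1, j))).
  all: split=> // k l.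
  all: try by case: eqP => [[-> ->]//|_]; rewrite addbF; exact: fv.
  all: move: (hvE k l); rewrite /cobound !xpair_eqE.
  all: by case: (h k l); case: (h k _); case: (v k l); case: (v _ l) => /=; lia.
Qed.

Lemma fillable_v i j : far i (j + 1) -> fillable (i, j) <-> fillable (i, j + 1).
Proof.
move=> fij; split=> -[h [v [fh fv hvE]]];
  exists (fun k l => h k l (+) ((k, l) == (i, j + 1))), v.
  all: split=> // k l.
  all: try by case: eqP => [[-> ->]//|_]; rewrite addbF; exact: fh.
  all: move: (hvE k l); rewrite /cobound !xpair_eqE.
  all: by case: (h k l); case: (h k _); case: (v k l); case: (v _ l) => /=; lia.
Qed.

Lemma fillable_seq (s : seq (int * int)) : (forall t, t \in s -> fillable t) ->
  exists h v, [/\ far_cochain h, far_cochain v &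
    forall i j, cobound h v i j = odd (count_mem (i, j) s)].
Proof.
elim: s => [_|t s IH fs].
  by exists (fun _ _ => false), (fun _ _ => false).
have [u us|h [v [fh fv hvE]]] := IH; first by apply: fs; rewrite inE us orbT.
have [h' [v' [fh' fv' hvE']]] := fs t (mem_head _ _).
exists (fun i j => h i j (+) h' i j), (fun i j => v i j (+) v' i j); split.
- move=> i j; case hij: (h i j); first by move=> _; exact: fh.
  by rewrite addFb; exact: fh'.
- move=> i j; case hij: (v i j); first by move=> _; exact: fv.
  by rewrite addFb; exact: fv'.
- move=> i j; rewrite /= oddD -hvE oddb eq_sym -hvE' /cobound.
  by do 2![case: (h i _); case: (h' i _)]; do 2![case: (v _ j); case: (v' _ j)].
Qed.

(** Adding fillings of the finitely many squares in the coboundary makes the cochain closed; as they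
    live on far edges, the primitive obtained is right on all other edges. *)
Lemma cochain_primitive h v (s : seq (int * int)) :
  (forall i j, cobound h v i j -> fillable (i, j) /\ (i, j) \in s) ->
  exists b : int -> int -> bool, forall i j, ~ far i j ->
    b (i + 1) j = b i j (+) h i j /\ b i (j + 1) = b i j (+) v i j.
Proof.
move=> hvs.
(* Duplicates must go, since fillings add up modulo 2. *)
pose s' := [seq t <- undup s | cobound h v t.1 t.2].
have [[i j]|h' [v' [fh' fv' hvE']]] := @fillable_seq s'.
  by rewrite mem_filter => /andP[/hvs[]].
have [|b bE] := @closed_cochain_exact
    (fun i j => h i j (+) h' i j) (fun i j => v i j (+) v' i j).
  move=> i j.
  transitivity (cobound h v i j (+) cobound h' v' i j).
    rewrite /cobound.
    by do 2![case: (h i _); case: (h' i _)]; do 2![case: (v _ j); case: (v' _ j)].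
  rewrite hvE' count_uniq_mem ?filter_uniq ?undup_uniq//.
  rewrite mem_filter mem_undup oddb /=.
  by case hvij: (cobound h v i j) => //; rewrite (hvs _ _ hvij).2.
exists b => i j nfar; have [-> ->] := bE i j.
have -> : h' i j = false by apply/negP => /fh'.
have -> : v' i j = false by apply/negP => /fv'.
by rewrite !addbF.
Qed.

End fillable.

(** * Connectedness and compactness in normed spaces *)

Lemma connected_locally_constant (T : topologicalType) (A P : set T) :
  connected A -> (forall a, A a -> \forall b \near a, A b -> (P a <-> P b)) ->
  forall x y, A x -> A y -> P x -> P y.
Proof.
move=> cA lc x y Ax Ay Px.
suff AP : A `&` P = A by move: Ay; rewrite -AP => -[].
apply: cA; first by exists x.
- exists (~` A `|` P)^°; first exact: open_interior.
  apply/seteqP; split=> a [Aa Pa]; split=> //.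
    apply: filterS (lc _ Aa) => b ab; have [Ab|] := pselect (A b); last by left.
    by right; apply/(ab Ab).
  by case: (interior_subset Pa).
- exists (~` (~` A `|` ~` P)^°); first exact/open_closedC/open_interior.
  apply/seteqP; split=> a [Aa Pa]; split=> //.
    by move=> /interior_subset[].
  apply: contrapT => nPa; apply: Pa; apply: filterS (lc _ Aa) => b ab.
  have [Ab|] := pselect (A b); last by left.
  by right=> /(ab Ab).
Qed.

Section metric.
Context {R : realType} {V : normedModType R}.
Implicit Types (x y : V) (A B K : set V) (r : R).

Lemma near_normP x (P : set V) : (\forall y \near x, P y) <->
  exists2 r, 0 < r & forall y, `|x - y| < r -> P y.
Proof.
split.
- by move=> /nbhs_normP[r r0 rP]; exists r.
- by move=> [r r0 rP]; apply/nbhs_normP; exists r.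
Qed.

Lemma nbhs_dist x r : 0 < r -> nbhs x [set y | `|x - y| < r].
Proof. by move=> r0; apply/near_normP; exists r. Qed.

Lemma open_normP (U : set V) : open U <->
  forall x, U x -> exists2 r, 0 < r & forall y, `|x - y| < r -> U y.
Proof.
rewrite openE; split=> oU x /oU; first by move/near_normP.
by move=> ?; apply/near_normP.
Qed.

Lemma open_dist x r : open [set y | `|x - y| < r].
Proof.
apply/open_normP => y /= xy; exists (r - `|x - y|); first by rewrite subr_gt0.
move=> z; rewrite ltrBrDl; apply: le_lt_trans.
by rewrite -[x - z](subrKA y) ler_normD.
Qed.

Lemma closed_far A x : closed A -> ~ A x ->
  exists2 r, 0 < r & forall y, A y -> r <= `|x - y|.
Proof.
move=> /closed_openC/open_normP cA /cA[r r0 rA]; exists r => // y Ay.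
by rewrite leNgt; apply/negP => /rA.
Qed.

Definition thickening K r : set V := [set x | exists2 k, K k & `|x - k| < r].

Lemma open_thickening K r : open (thickening K r).
Proof.
apply/open_normP => x [k Kk xk]; exists (r - `|x - k|); first by rewrite subr_gt0.
move=> y; rewrite distrC ltrBrDr => yx; exists k => //.
by apply: le_lt_trans yx; rewrite -[y - k](subrKA x) ler_normD.
Qed.

Lemma sub_thickening K r : 0 < r -> K `<=` thickening K r.
Proof. by move=> r0 k Kk; exists k => //; rewrite subrr normr0. Qed.

Lemma compact_gap A B : compact A -> closed B -> A `&` B = set0 ->
  exists2 r, 0 < r & forall a b, A a -> B b -> r <= `|a - b|.
Proof.
move=> cA cB AB0.
have H : \forall r \near 0^'+, A `<=` [set a | forall b, B b -> r <= `|a - b|].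
  apply: (compact_near_coveringP A).1 => // a Aa.
  have nBa : ~ B a by move=> Ba; have : (A `&` B) a by []; rewrite AB0.
  have [s s0 sB] := closed_far cB nBa.
  exists ([set x | `|a - x| < s / 2], [set r | r < s / 2]).
    split => /=.
      by apply/near_normP; exists (s / 2) => //; lra.
    by apply: nbhs_right_lt; lra.
  move=> [x r] /= [ax rs] b Bb; have := sB b Bb.
  have := ler_normD (a - x) (x - b); rewrite subrKA; lra.
near (0 : R)^'+ => r.
exists r; first by near: r; exact: nbhs_right_gt.
move=> a b Aa Bb.
have : A `<=` [set a | forall b, B b -> r <= `|a - b|] by near: r.
by move=> /(_ _ Aa)/(_ _ Bb).
Unshelve. all: by end_near. Qed.

Lemma compact_norm_le K : compact K -> exists2 M, 0 < M & forall k, K k -> `|k| <= M.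
Proof.
move=> /compact_bounded[M [_ MK]].
exists (Num.max M 0 + 1); first by rewrite ltr_pwDr// le_max lexx orbT.
move=> k Kk; apply: (MK (Num.max M 0 + 1)) => //.
by rewrite ltr_pwDr// le_max lexx.
Qed.

(** The part of [A] off a thickening of the intersection is compact and disjoint from [B], hence at
    positive distance from [B]; a point close enough to both sets is not close to that part. *)
Lemma thickening_inter A B r : compact A -> compact B -> 0 < r ->
  exists2 d, 0 < d &
    thickening A d `&` thickening B d `<=` thickening (A `&` B) r.
Proof.
move=> cA cB r0.
have hV : hausdorff_space V by exact: norm_hausdorff.
have cA' : compact (A `&` ~` thickening (A `&` B) (r / 2)).
  by apply: compact_closedI => //; apply/open_closedC/open_thickening.
have [|d d0 dP] := compact_gap cA' (compact_closed hV cB).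
  apply/seteqP; split=> // x [[Ax nx] Bx]; apply: nx.
  by apply: sub_thickening => //; lra.
exists (Num.min (d / 2) (r / 2)).
  by rewrite lt_min; apply/andP; split; lra.
move=> x [[a Aa]]; rewrite lt_min => /andP[xad xar].
move=> [b Bb]; rewrite lt_min => /andP[xbd xbr].
have [[k Kk ak]|na] := pselect (thickening (A `&` B) (r / 2) a).
  exists k => //; have := ler_normD (x - a) (a - k); rewrite subrKA; lra.
have := dP a b (conj Aa na) Bb.
have := ler_normD (a - x) (x - b); rewrite subrKA (distrC a x); lra.
Qed.

End metric.

(* Kept as a constant, so that norms on it are elaborated through the same instance
   as in an abstract normed module. *)
Definition plane (R : realType) : normedModType R := (R * R)%type.

(** * Square grids of mesh [e] in the plane *)

Section grid.
Context {R : realType} (e : R).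
Hypothesis e0 : 0 < e.
Local Notation plane := (plane R).
Implicit Types (x y : plane) (S : int -> int -> Prop).

Definition vtx (i j : int) : plane := (i%:~R * e, j%:~R * e).
Definition cell x : int * int := (Num.floor (x.1 / e), Num.floor (x.2 / e)).

Lemma plane_norm_lt x (r : R) : (`|x| < r) = (`|x.1| < r) && (`|x.2| < r).
Proof. by rewrite prod_normE gt_max. Qed.

Lemma plane_norm_le x (r : R) : (`|x| <= r) = (`|x.1| <= r) && (`|x.2| <= r).
Proof. by rewrite prod_normE ge_max. Qed.

Lemma cell_vtx i j : cell (vtx i j) = (i, j).
Proof. by rewrite /cell /vtx /= !mulfK ?gt_eqF// !intrKfloor. Qed.

Lemma floor_bounds (a : R) :
  (Num.floor (a / e))%:~R * e <= a < ((Num.floor (a / e))%:~R + 1) * e.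
Proof.
have := floor_itv (a / e); rewrite intrD.
by rewrite ler_pdivlMr// ltr_pdivrMr.
Qed.

Lemma floor_near (a b : R) : `|a - b| < e ->
  Num.floor (a / e) - 1 <= Num.floor (b / e) <= Num.floor (a / e) + 1.
Proof.
have := floor_bounds a; have := floor_bounds b.
move: (Num.floor _) (Num.floor _) => i j.
rewrite ltr_norml => /andP[h1 h2] /andP[h3 h4] /andP[h5 h6].
rewrite -!ltzD1 -!(ltr_int R) !intrD; apply/andP.
have lt_e (m n : R) : m * e < n * e -> m < n by rewrite ltr_pM2r.
split; apply: lt_e; rewrite ?intrN; lra.
Qed.

Lemma vtx_near x k l : (cell x).1 - 1 <= k <= (cell x).1 + 1 ->
  (cell x).2 - 1 <= l <= (cell x).2 + 1 -> `|vtx k l - x| < 2 * e.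
Proof.
have aux (a : R) (m : int) :
    Num.floor (a / e) - 1 <= m <= Num.floor (a / e) + 1 ->
    `|m%:~R * e - a| < 2 * e.
  have := floor_bounds a.
  move: (Num.floor _) => i /andP[h1 h2]; rewrite -!(ler_int R) !intrD.
  move=> /andP[/(ler_wpM2r (ltW e0)) + /(ler_wpM2r (ltW e0))] /=.
  rewrite intrN => h3 h4.
  rewrite ltr_norml; apply/andP; split; lra.
by move=> hk hl; rewrite plane_norm_lt /= !aux.
Qed.

Lemma vtx_cell_near x : `|vtx (cell x).1 (cell x).2 - x| < 2 * e.
Proof. by apply: vtx_near; lia. Qed.

(** In the sup norm, points less than [e] apart lie in equal or adjacent squares, so at most one
    horizontal and one vertical step join the lower left corners, all within [2 * e] of [x]. *)
Lemma grid_walk S x y : `|x - y| < e ->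
  (forall i j, `|vtx i j - x| < 2 * e ->
     (`|vtx (i + 1) j - x| < 2 * e -> (S i j <-> S (i + 1) j)) /\
     (`|vtx i (j + 1) - x| < 2 * e -> (S i j <-> S i (j + 1)))) ->
  S (cell x).1 (cell x).2 <-> S (cell y).1 (cell y).2.
Proof.
rewrite plane_norm_lt => /andP[/floor_near/= xy1 /floor_near/= xy2] walk.
have near := @vtx_near x; rewrite /cell /= in near *.
move: (Num.floor (x.1 / e)) (Num.floor (x.2 / e)) near xy1 xy2 => i j near.
move: (Num.floor (y.1 / e)) (Num.floor (y.2 / e)) => i' j' ii' jj'.
have hstep k l : i - 1 <= k <= i + 1 -> i - 1 <= k + 1 <= i + 1 ->
    j - 1 <= l <= j + 1 -> S k l <-> S (k + 1) l.
  by move=> ? ? ?; apply: (walk k l _).1; exact: near.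
have vstep k l : i - 1 <= k <= i + 1 -> j - 1 <= l <= j + 1 ->
    j - 1 <= l + 1 <= j + 1 -> S k l <-> S k (l + 1).
  by move=> ? ? ?; apply: (walk k l _).2; exact: near.
have hE : S i j <-> S i' j.
  have [->//|[->|->]] : i' = i \/ i' = i + 1 \/ i' = i - 1 by lia.
    by apply: hstep; lia.
  by rewrite -{1}(subrK 1 i); symmetry; apply: hstep; lia.
rewrite hE.
have [->//|[->|->]] : j' = j \/ j' = j + 1 \/ j' = j - 1 by lia.
  by apply: vstep; lia.
by rewrite -{1}(subrK 1 j); symmetry; apply: vstep; lia.
Qed.

Lemma connected_grid S (C : set plane) : connected C ->
  (forall x, C x -> forall i j, `|vtx i j - x| < 2 * e ->
     (`|vtx (i + 1) j - x| < 2 * e -> (S i j <-> S (i + 1) j)) /\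
     (`|vtx i (j + 1) - x| < 2 * e -> (S i j <-> S i (j + 1)))) ->
  forall x y, C x -> C y -> S (cell x).1 (cell x).2 -> S (cell y).1 (cell y).2.
Proof.
move=> cC walk.
apply: (@connected_locally_constant _ _ (fun x => S (cell x).1 (cell x).2) cC).
move=> x Cx; apply/near_normP; exists e => // y xy _.
by apply: grid_walk => //; exact: walk.
Qed.

End grid.

(** * Janiszewski's theorem *)

Section janiszewski_grid.
Context {R : realType}.
Local Notation plane := (plane R).
(** The mesh is [g]; within [d] of both [A] and [B], a point is within [c] of [P] or of [Q], which
    are at least [4 * c] apart. *)
Variables (A B P Q : set plane) (M c d g : R).
Hypotheses (cA : connected A) (cB : connected B) (ABPQ : A `&` B = P `|` Q).
Hypotheses (P0 : P !=set0) (Q0 : Q !=set0).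
Hypothesis gP : [/\ 0 < g, g <= c, 4 * g <= d & g <= 1].
Hypothesis PQc : forall p q, P p -> Q q -> 4 * c <= `|p - q|.
Hypothesis ABd : thickening A d `&` thickening B d `<=` thickening (A `&` B) c.
Hypothesis KM : forall x, (A `|` B) x -> `|x| <= M.

Let g0 : 0 < g. Proof. by case: gP. Qed.

Let far i j := ~ thickening (A `|` B) (2 * g) (vtx g i j).
Let nearA i j := `[< thickening A d (vtx g i j) >].
Let nearQ i j := `[< thickening Q (2 * c) (vtx g i j) >].
(** On edges starting near [A] this is the coboundary of [nearQ]; it is cut off to zero elsewhere,
    and near [B] it vanishes by [hv_nearB]. *)
Let h i j := nearA i j && (nearQ i j (+) nearQ (i + 1) j).
Let v i j := nearA i j && (nearQ i j (+) nearQ i (j + 1)).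

Let vtx_adj i j : `|vtx g (i + 1) j - vtx g i j| <= g /\
                  `|vtx g i (j + 1) - vtx g i j| <= g.
Proof.
rewrite !plane_norm_le /= !subrr normr0 !intrD !mulrDl !mul1r.
by rewrite ![_ + g]addrC !addrK (ger0_norm (ltW g0)) lexx (ltW g0).
Qed.

Let thickening_move K r s (x y : plane) :
  `|y - x| <= g -> r + g <= s -> thickening K r x -> thickening K s y.
Proof.
move=> yx rs [k Kk xk]; exists k => //.
have := ler_normD (y - x) (x - k); rewrite subrKA; lra.
Qed.

(** Both [x] and [y] are within [2 * c] of the same point of [P] or of [Q], and the gap [4 * c] then
    excludes being within [2 * c] of the other set. *)
Let nearQ_const x y : thickening A d x -> thickening B d x -> `|y - x| <= g ->
  `[< thickening Q (2 * c) x >] = `[< thickening Q (2 * c) y >].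
Proof.
have [? ? ? ?] := gP; move=> Ax Bx yx; have [k + xk] := ABd (conj Ax Bx).
have xk2 : `|x - k| < 2 * c by lra.
have yk2 : `|y - k| < 2 * c.
  have := ler_normD (y - x) (x - k); rewrite subrKA; lra.
rewrite ABPQ => -[Pk|Qk].
  have nQ z : `|z - k| < 2 * c -> `[< thickening Q (2 * c) z >] = false.
    move=> zk; apply/asboolP => -[q Qq zq]; have := PQc Pk Qq.
    have := ler_normD (k - z) (z - q); rewrite subrKA (distrC k z); lra.
  by rewrite !nQ.
have yQ z : `|z - k| < 2 * c -> `[< thickening Q (2 * c) z >] = true.
  by move=> zk; apply/asboolP; exists k.
by rewrite !yQ.
Qed.

Let hv_nearB i j : thickening B d (vtx g i j) -> h i j = false /\ v i j = false.
Proof.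
move=> nB; rewrite /h /v; have [a1 a2] := vtx_adj i j.
have [nA|//] := boolP (nearA i j); have {}nA := asboolW nA.
by rewrite /nearQ -(nearQ_const nA nB a1) -(nearQ_const nA nB a2) addbb.
Qed.

(** Near [A] the cochain is a coboundary, hence closed; near [B] it is zero. The margin from [d / 2]
    to [d] covers all four edges of the square. *)
Let cobound_far i j : cobound h v i j ->
  ~ thickening (A `|` B) (d / 2) (vtx g i j).
Proof.
have [[a1 a2] [? ? ? ?]] := (vtx_adj i j, gP).
move=> + [k [Kk|Kk] xk].
  have nA x : `|x - vtx g i j| <= g -> `[< thickening A d x >].
    by move=> xg; apply/asboolP; apply: (thickening_move xg (r := d / 2)); [lra|exists k].
  have nA0 : nearA i j by apply: nA; rewrite subrr normr0 ltW.
  have nA1 : nearA (i + 1) j by exact: nA.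
  have nA2 : nearA i (j + 1) by exact: nA.
  rewrite /cobound /h /v nA0 nA1 nA2 /=.
  by do 2!case: (nearQ i _); do 2!case: (nearQ (i + 1) _).
have nB x : `|x - vtx g i j| <= g -> thickening B d x.
  by move=> xg; apply: (thickening_move xg (r := d / 2)); [lra|exists k].
rewrite /cobound.
rewrite (hv_nearB _).1; last by apply: nB; rewrite subrr normr0 ltW.
rewrite (hv_nearB _).2; last by apply: nB; rewrite subrr normr0 ltW.
by rewrite (hv_nearB (nB _ a1)).2 (hv_nearB (nB _ a2)).1.
Qed.

Let cobound_support :
  exists s : seq (int * int), forall i j, cobound h v i j -> (i, j) \in s.
Proof.
pose N := `|Num.floor ((M + 2 * d) / g)|%N.+1.
pose r : seq int := [seq k%:Z - N%:Z | k <- iota 0 (2 * N).+1].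
have memr (k : int) : `|k%:~R * g| <= M + 2 * d -> k \in r.
  move=> kM.
  have kN : (`|k| <= N)%N.
    suff : `|k| <= Num.floor ((M + 2 * d) / g) by rewrite /N; lia.
    by rewrite floor_ge_int intr_norm ler_pdivlMr// -{1}(gtr0_norm g0) -normrM.
  apply/mapP; exists (absz (k + N%:Z)%R); last by lia.
  by rewrite mem_iota; lia.
exists [seq (i, j) | i <- r, j <- r] => i j ij.
have [? ? ? ?] := gP; suff vM : `|vtx g i j| <= M + 2 * d.
  by move: vM; rewrite plane_norm_le => /andP[? ?]; apply/allpairsP; exists (i, j); split=> //; exact: memr.
have [a1 a2] := vtx_adj i j.
have near x : `|x - vtx g i j| <= g -> thickening A d x -> `|vtx g i j| <= M + 2 * d.
  move=> xg [k Ak xk]; have := KM (or_introl Ak).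
  have := ler_normD (vtx g i j - x) (x - k).
  have := ler_normD (vtx g i j - k) k.
  rewrite subrKA subrK (distrC _ x); lra.
have [/asboolP|nA] := boolP (nearA i j); first by apply: near; rewrite subrr normr0 ltW.
have [/asboolP|nA1] := boolP (nearA (i + 1) j); first exact: near.
have [/asboolP|nA2] := boolP (nearA i (j + 1)); first exact: near.
by move: ij; rewrite /cobound /h /v (negbTE nA) (negbTE nA1) (negbTE nA2).
Qed.

Let near_notfar (K : set plane) x i j : K `<=` A `|` B -> K x ->
  `|vtx g i j - x| < 2 * g -> ~ far i j.
Proof. by move=> KAB Kx ijx; apply; exists x => //; exact: KAB. Qed.

(** Otherwise there is a primitive [b] close to the continua. Along [A] the sum of [b] and [nearQ]
    is constant, along [B] so is [b]; then [nearQ] would agree at [p] and [q]. *)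
Let not_fillable : exists i j,
  ~ fillable far (i, j) /\ ~ thickening (A `|` B) (d / 2) (vtx g i j).
Proof.
have [? ? ? ?] := gP; apply: contrapT => nex.
have [s sP] := cobound_support.
have [|b bE] := @cochain_primitive far h v s.
  move=> i j ij; split; last exact: sP.
  apply: contrapT => nf; apply: nex; exists i, j; split=> //.
  exact: cobound_far.
have [[p Pp] [q Qq]] := (P0, Q0).
have [[Ap Bp] [Aq Bq]] : (A `&` B) p /\ (A `&` B) q.
  by rewrite ABPQ; split; [left|right].
have bA : b (cell g p).1 (cell g p).2 (+) nearQ (cell g p).1 (cell g p).2 =
          b (cell g q).1 (cell g q).2 (+) nearQ (cell g q).1 (cell g q).2.
  pose S i j := b (cell g p).1 (cell g p).2 (+) nearQ (cell g p).1 (cell g p).2 =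
                b i j (+) nearQ i j.
  apply: (@connected_grid _ _ g0 S A cA _ p q Ap Aq) (erefl _).
  move=> x Ax i j ijx; rewrite /S.
  have nf := near_notfar (@subsetUl _ _ _) Ax ijx.
  have nA : nearA i j.
    by apply/asboolP; exists x => //; apply: lt_le_trans ijx _; lra.
  by have [-> ->] := bE _ _ nf; rewrite /h /v nA !andTb !addbA !addbK.
have bB : b (cell g p).1 (cell g p).2 = b (cell g q).1 (cell g q).2.
  pose S i j := b (cell g p).1 (cell g p).2 = b i j.
  apply: (@connected_grid _ _ g0 S B cB _ p q Bp Bq) (erefl _).
  move=> x Bx i j ijx; rewrite /S.
  have nf := near_notfar (@subsetUr _ _ _) Bx ijx.
  have [-> ->] := bE _ _ nf.
  have [|-> ->] := @hv_nearB i j; last by rewrite addbF.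
  by exists x => //; apply: lt_le_trans ijx _; lra.
have : nearQ (cell g q).1 (cell g q).2.
  apply/asboolP; exists q => //.
  by apply: lt_le_trans (vtx_cell_near g0 q) _; lra.
have : ~~ nearQ (cell g p).1 (cell g p).2.
  apply/asboolP => -[k Qk pk]; have := PQc Pp Qk; have := vtx_cell_near g0 p.
  have := ler_normD (p - vtx g (cell g p).1 (cell g p).2)
                    (vtx g (cell g p).1 (cell g p).2 - k).
  rewrite subrKA (distrC p (vtx _ _ _)); lra.
move: bA; rewrite bB.
by do 3!case: (_ (cell g _).1 (cell g _).2).
Qed.

(** A horizontal ray pointing away from the continua stays far; if the height is what is large, the
    whole row is far. Of the margin 3, passing to a corner takes at most 1 and [far] takes
    [2 * g]. *)
Let far_fillable x : M + 3 < `|x| -> fillable far (cell g x).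
Proof.
have [? ? ? ?] := gP; have far_norm i j : M + 2 < `|vtx g i j| -> far i j.
  move=> ijM [k /KM kM ijk].
  have := ler_normD (vtx g i j - k) k; rewrite subrK; lra.
have le_e (m n : int) : m <= n -> m%:~R * g <= n%:~R * g.
  by move=> mn; rewrite ler_pM2r// ler_int.
rewrite ltNge plane_norm_le negb_and -!ltNge => xM.
have := floor_bounds g0 x.1; have := floor_bounds g0 x.2; rewrite /cell.
move: (Num.floor _) (Num.floor _) => i j /andP[j1 j2] /andP[i1 i2].
move: xM => /orP[]; rewrite lter_normr => /orP[] xM.
- apply: fillable_right => k ik; apply: far_norm.
  rewrite ltNge plane_norm_le negb_and -!ltNge /= lter_normr; apply/orP; left.
  have := le_e (i + 1) k; rewrite intrD lezD1 => /(_ ik); lra.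
- apply: fillable_left => k ik; apply: far_norm.
  rewrite ltNge plane_norm_le negb_and -!ltNge /= lter_normr; apply/orP; left.
  apply/orP; right.
  have := le_e _ _ ik; lra.
- apply: fillable_right => k ik; apply: far_norm.
  rewrite ltNge plane_norm_le negb_and -!ltNge /= !lter_normr; apply/orP; right.
  apply/orP; left; lra.
- apply: fillable_right => k ik; apply: far_norm.
  rewrite ltNge plane_norm_le negb_and -!ltNge /= !lter_normr; apply/orP; right.
  apply/orP; right; lra.
Qed.

(** The witness is the union of the squares that cannot be filled. A connected set off the [4 * g]
    thickening crosses only far edges, which preserve fillability. *)
Lemma janiszewski_grid : exists W : set plane,
  [/\ forall x, W x -> `|x| <= M + 3,
      exists2 w, W w & ~ thickening (A `|` B) (d / 2) w &
      forall C : set plane, connected C ->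
        C `&` thickening (A `|` B) (4 * g) = set0 ->
        forall x y, C x -> C y -> W x -> W y].
Proof.
have [? ? ? ?] := gP; exists [set x | ~ fillable far (cell g x)]; split.
- move=> x /= nf; rewrite leNgt; apply/negP => xM; exact/nf/far_fillable.
- have [i [j [nf nK]]] := not_fillable.
  by exists (vtx g i j) => //=; rewrite cell_vtx.
- move=> C cC CK x y Cx Cy.
  apply: (connected_grid g0 (S := fun i j => ~ fillable far (i, j)) cC _ Cx Cy).
  move=> {Cx Cy y} {}x Cx.
  have ffar k l : `|vtx g k l - x| < 2 * g -> far k l.
    move=> klx [z Kz klz]; suff : (C `&` thickening (A `|` B) (4 * g)) x by rewrite CK.
    split=> //; exists z => //.
    have := ler_normD (x - vtx g k l) (vtx g k l - z); rewrite subrKA (distrC x (vtx _ _ _)).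
    lra.
  move=> i j ijx; split=> /ffar f1.
    by have [? ?] := fillable_h f1; split; exact: contra_not.
  by have [? ?] := fillable_v f1; split; exact: contra_not.
Qed.

End janiszewski_grid.

(** * Segments and star-shaped sets *)

Section segment.
Context {R : realType} {V : normedModType R}.
Implicit Types (x y z : V) (S U : set V).

Definition seg x y : set V := [set x + t *: (y - x) | t in `[0, 1]].

Lemma seg_left x y : seg x y x.
Proof. by exists 0; rewrite ?scale0r ?addr0//= in_itv /= lexx ler01. Qed.

Lemma seg_right x y : seg x y y.
Proof. by exists 1; rewrite ?scale1r ?subrKC//= in_itv /= ler01 lexx. Qed.

Lemma continuous_line x y : continuous (fun t : R => x + t *: (y - x)).
Proof. by move=> t; apply: cvgD; [exact: cvg_cst|apply: cvgZr_tmp; exact: cvg_id]. Qed.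

Lemma compact_seg x y : compact (seg x y).
Proof.
apply: continuous_compact; last exact: segment_compact.
exact/continuous_subspaceT/continuous_line.
Qed.

Lemma connected_seg x y : connected (seg x y).
Proof.
apply: connected_continuous_connected; first exact: segment_connected.
exact/continuous_subspaceT/continuous_line.
Qed.

Definition star_shaped z S := forall x, S x -> seg z x `<=` S.

Lemma star_shaped_seg x y : star_shaped x (seg x y).
Proof.
move=> _ [t + <-] _ [s + <-]; rewrite /= !in_itv /= => /andP[t0 t1] /andP[s0 s1].
exists (s * t); first by rewrite /= in_itv /= mulr_ge0// mulr_ile1.
by rewrite [x + _ - x]addrC addKr scalerA.
Qed.

Lemma star_shapedU z S S' :
  star_shaped z S -> star_shaped z S' -> star_shaped z (S `|` S').
Proof. by move=> sS sS' x [/sS|/sS'] h y /h; [left|right]. Qed.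

Lemma seg_ball z r x y : `|z - x| < r -> `|z - y| < r ->
  seg x y `<=` [set u | `|z - u| < r].
Proof.
move=> zx zy _ [t + <-]; rewrite /= in_itv /= => /andP[t0 t1].
have -> : z - (x + t *: (y - x)) = (1 - t) *: (z - x) + t *: (z - y).
  rewrite scalerBl scale1r -[in RHS]addrA -scalerN -scalerDr opprB subrKA.
  by rewrite opprD addrA -scalerN opprB.
apply: le_lt_trans (ler_normD _ _) _; rewrite !normrZ.
rewrite (ger0_norm t0) (ger0_norm (_ : 0 <= 1 - t)) ?subr_ge0//.
set m := Num.max `|z - x| `|z - y|; have mr : m < r by rewrite gt_max zx.
have zxm : `|z - x| <= m by rewrite le_max lexx.
have zym : `|z - y| <= m by rewrite le_max lexx orbT.
apply: le_lt_trans mr; apply: (@le_trans _ _ ((1 - t) * m + t * m)); last by lra.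
by apply: lerD; rewrite ler_wpM2l// subr_ge0.
Qed.

Lemma star_shaped_ball z r : 0 < r -> star_shaped z [set u | `|z - u| < r].
Proof. by move=> r0 x zx; apply: seg_ball => //; rewrite subrr normr0. Qed.

(* A ray issued from the centre of [S] that leaves [S] never comes back. *)
Lemma star_shaped_fill z S U M : star_shaped z S -> S z -> open U ->
  (forall x, U x -> `|x| <= M) -> closure U `<=` U `|` S -> U `<=` S.
Proof.
move=> sS Sz oU UM US p Up; apply: contrapT => nSp.
pose ray := [set z + t *: (p - z) | t in `[1, +oo[].
have ray_conn : connected ray.
  apply: connected_continuous_connected.
    exact/connected_intervalP/interval_is_interval.
  exact/continuous_subspaceT/continuous_line.
have rayS x : ray x -> ~ S x.
  move=> [t + <-] Sx; rewrite /= in_itv /= andbT => t1; apply: nSp.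
  have t0 : 0 < t by exact: lt_le_trans t1.
  apply: (sS _ Sx); exists t^-1.
    by rewrite /= in_itv /= invr_ge0 ltW //= invf_le1.
  by rewrite [z + _ - z]addrC addKr scalerA mulVf ?gt_eqF// scale1r subrKC.
have rayU x : ray x -> U x.
  move=> rx; apply: (@connected_locally_constant _ _ U ray_conn _ p x) => //.
    move=> {rx}x rx; have [Ux|nUx] := pselect (U x).
      by apply: filterS (open_nbhs_nbhs (conj oU Ux)).
    have : ~ closure U x by move=> /US[//|]; exact: rayS.
    move=> ncU; have : open_nbhs x (~` closure U).
      by split=> //; exact/closed_openC/closed_closure.
    move=> /open_nbhs_nbhs; apply: filterS => y ny _; split=> // Uy.
    by exfalso; apply/ny/subset_closure.
  exists 1; rewrite ?scale1r ?subrKC//= in_itv /= lexx//.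
have pz : 0 < `|p - z|.
  by rewrite normr_gt0 subr_eq0; apply/eqP => pz; apply: nSp; rewrite pz.
(* At this parameter the norm exceeds [M], although the ray lies in [U]. *)
pose t := 1 + (`|M| + `|z|) / `|p - z|.
have t1 : 1 <= t by rewrite lerDl divr_ge0// addr_ge0.
have /rayU/UM : ray (z + t *: (p - z)) by exists t; rewrite //= in_itv /= t1.
have := ler_normD (- z) (z + t *: (p - z)); rewrite addKr normrN normrZ.
rewrite (ger0_norm (le_trans ler01 t1)) /t mulrDl mul1r divfK ?gt_eqF//.
have := ler_norm M; lra.
Qed.

End segment.

Lemma plane_closed_ball_compact (R : realType) (x : plane R) (r : R) :
  compact [set u | `|x - u| <= r].
Proof.
have -> : [set u | `|x - u| <= r] =
    `[x.1 - r, x.1 + r] `*` `[x.2 - r, x.2 + r].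
  apply/seteqP; split=> u /=; rewrite plane_norm_le /= !in_itv /= !ler_distlC.
    by move=> /andP[].
  by move=> [-> ->].
by apply: compact_setX; exact: segment_compact.
Qed.

(* The mod 2 argument separates [A `|` B] only up to the mesh of the grid; the
   separating set is the upper limit of the sets obtained at smaller meshes. *)
Theorem janiszewski (R : realType) (A B P Q : set (plane R)) :
  compact A -> compact B -> connected A -> connected B ->
  A `&` B = P `|` Q -> closed P -> closed Q -> P `&` Q = set0 ->
  P !=set0 -> Q !=set0 ->
  exists W : set (plane R), [/\ open W, W !=set0,
    exists M, forall x, W x -> `|x| <= M,
    W `&` (A `|` B) = set0 & closure W `<=` W `|` (A `|` B)].
Proof.
move=> kA kB cA cB ABPQ clP clQ PQ0 P0 Q0.
have hV : hausdorff_space (plane R) by exact: norm_hausdorff.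
have kAB := compactU kA kB.
have cAB := compact_closed hV kAB.
have kP : compact P.
  apply: subclosed_compact clP kA _ => x Px.
  by have [] : (A `&` B) x by rewrite ABPQ; left.
have [c c0 PQc] := compact_gap kP clQ PQ0.
have [|d d0 ABd] := thickening_inter kA kB (r := c / 4); first by lra.
have [M M0 KM] := compact_norm_le kAB.
pose g n : R := Num.min (Num.min (c / 4) (d / 4)) 1 * n.+1%:R^-1.
have gm : 0 < Num.min (Num.min (c / 4) (d / 4)) 1.
  by rewrite !lt_min; apply/andP; split=> //; apply/andP; split; lra.
have gP n : [/\ 0 < g n, g n <= c / 4, 4 * g n <= d & g n <= 1].
  have : g n <= Num.min (Num.min (c / 4) (d / 4)) 1.
    by rewrite ger_pMr// invf_le1// ler1n.
  rewrite !le_min => /andP[/andP[? ?] ?]; split=> //; last by lra.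
  by rewrite mulr_gt0.
have PQc4 p q : P p -> Q q -> 4 * (c / 4) <= `|p - q|.
  by move=> Pp Qq; apply: le_trans (PQc p q Pp Qq); lra.
have [W WP] := choice (fun n => janiszewski_grid cA cB ABPQ P0 Q0 (gP n) PQc4 ABd KM).
have g_small r : 0 < r -> exists N, forall n, (N <= n)%N -> 4 * g n <= r.
  move=> r0; exists (Num.truncn (4 / r)) => n Nn.
  apply: (@le_trans _ _ (4 * n.+1%:R^-1)).
    rewrite ler_pM2l// ler_piMl ?invr_ge0//; first by rewrite !ge_min lexx !orbT.
  rewrite ler_pdivrMr// mulrC -ler_pdivrMr//.
  by apply/ltW/(lt_le_trans (truncnS_gt _)); rewrite ler_nat ltnS.
(* On a small ball off the continua, membership in [W n] is constant once the mesh is small, since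
   segments join the points of the ball. *)
have W_stable u : ~ (A `|` B) u -> exists r, exists N, [/\ 0 < r,
    forall y, `|u - y| < r -> ~ (A `|` B) y &
    forall n, (N <= n)%N -> forall x y, `|u - x| < r -> `|u - y| < r ->
      W n x -> W n y].
  move=> nKu; have [r r0 rK] := closed_far cAB nKu.
  have [|N Ng] := g_small (r / 2); first by lra.
  exists (r / 2), N; split; first by lra.
    by move=> y uy Ky; have := rK y Ky; lra.
  move=> n Nn x y ux uy.
  have [_ _ Wn] := WP n.
  apply: (Wn _ (@connected_seg _ _ x y) _ x y (seg_left x y) (seg_right x y)).
  apply/seteqP; split=> // z [/(seg_ball ux uy) /= uz [k Kk zk]].
  have := rK k Kk; have := ler_normD (u - z) (z - k); rewrite subrKA.
  have := Ng n Nn; lra.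
exists [set u | ~ (A `|` B) u /\ forall m, exists2 n, (m <= n)%N & W n u].
split.
- apply/open_normP => u [nKu Wu]; have [r [N [r0 rK rW]]] := W_stable u nKu.
  exists r => // y uy; split; first exact: rK.
  move=> m; have [n] := Wu (maxn m N); rewrite geq_max => /andP[mn Nn] Wnu.
  by exists n => //; apply: (rW n Nn u y) => //; rewrite subrr normr0.
(* The points [w n] of [W n] keep a distance [d / 2] from the continua; a cluster point of them is
   off the continua and lies in infinitely many [W n]. *)
- have [w wW] := choice (fun n => let: And3 _ (ex_intro2 x Wx Kx) _ := WP n in
    ex_intro (fun x => W n x /\ ~ thickening (A `|` B) (d / 2) x) x (conj Wx Kx)).
  have [|u [_ uw]] := @plane_closed_ball_compact R 0 (M + 3) (w @ \oo) _.
    exists 0%N => // n _ /=; have [WM _ _] := WP n.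
    by rewrite sub0r normrN; apply/WM/(wW n).1.
  have freq r m : 0 < r -> exists2 n, (m <= n)%N & `|u - w n| < r.
    move=> r0; have [||_ [[n mn <-] /= ur]] := uw (w @` [set n | (m <= n)%N]) [set y | `|u - y| < r].
    + by exists m => // n /= mn; exists n.
    + exact: nbhs_dist.
    + by exists n.
  have nKu : ~ (A `|` B) u.
    move=> Ku; have [|n _ un] := freq (d / 2) 0%N; first by lra.
    by apply: (wW n).2; exists u => //; rewrite distrC.
  exists u; split=> // m; have [r [N [r0 _ rW]]] := W_stable u nKu.
  have [n] := freq r (maxn m N) r0; rewrite geq_max => /andP[mn Nn] un.
  exists n => //; apply: (rW n Nn (w n) u) => //; last exact: (wW n).1.
  by rewrite subrr normr0.
- exists (M + 3) => x [_ /(_ 0%N)[n _ Wnx]].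
  by have [WM _ _] := WP n; exact: WM.
- by apply/seteqP; split=> // x [[]].
- move=> u cu; have [|nKu] := pselect ((A `|` B) u); first by right.
  have [r [N [r0 _ rW]]] := W_stable u nKu; left; split=> // m.
  have [y [[_ Wy] /= uy]] := cu _ (nbhs_dist u r0).
  have [n] := Wy (maxn m N); rewrite geq_max => /andP[mn Nn] Wny.
  by exists n => //; apply: (rW n Nn y u) => //; rewrite subrr normr0.
Qed.

(** * Open discrete maps of the plane *)

(* A clopen piece of the preimage of [L] has a clopen image in [L], hence it
   meets the fibre of [F x0]. *)
Lemma preimage_connected (X Y : topologicalType) (F : X -> Y) (D : set X)
    (L : set Y) (x0 : X) :
  hausdorff_space Y -> connected L -> L (F x0) -> D x0 ->
  (forall x, D x -> F x = F x0 -> x = x0) ->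
  (forall x, D x -> {for x, continuous F}) ->
  open D -> (forall U, open U -> U `<=` D -> open (F @` U)) ->
  compact (D `&` F @^-1` L) -> connected (D `&` F @^-1` L).
Proof.
move=> hY cL Lx0 Dx0 inj0 contF oD openF; set E := D `&` _ => kE.
have x0_clopen B : B !=set0 -> (exists2 C, open C & B = E `&` C) ->
    (exists2 C, closed C & B = E `&` C) -> B x0.
  move=> [b Bb] [C oC BC] [C' cC' BC'].
  have FBL : F @` B = L.
    apply: cL; first by exists (F b), b.
    - exists (F @` (D `&` C)); first by apply: openF; [exact: openI|move=> x []].
      apply/seteqP; split=> y.
        by rewrite BC => -[x [[Dx Lx] Cx] <-]; split=> //; exists x.
      by move=> [Ly [x [Dx Cx] Fxy]]; exists x => //; rewrite BC /E /= Fxy.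
    - exists (F @` B); last first.
        apply/seteqP; split=> [y [x Bx <-]|y []//]; split; last by exists x.
        by move: Bx; rewrite BC => -[[]].
      apply: compact_closed => //; apply: continuous_compact; last first.
        by rewrite BC'; exact: compact_closedI.
      apply: continuous_in_subspaceT => x /set_mem Bx; apply: contF.
      by move: Bx; rewrite BC => -[[]].
  have [x Bx Fx] : (F @` B) (F x0) by rewrite FBL.
  have [[Dx _] _] : (E `&` C) x by rewrite -BC.
  by rewrite -(inj0 x Dx Fx).
move=> B B0 [C oC BC] [C' cC' BC'].
apply/seteqP; split=> [x|x Ex]; first by rewrite BC => -[].
apply: contrapT => nBx.
have Bx0 : B x0 by apply: x0_clopen => //; [exists C|exists C'].
suff : (E `\` B) x0 by move=> [].
apply: x0_clopen; first by exists x.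
- exists (~` C'); first exact: closed_openC.
  rewrite BC'; apply/seteqP; split=> y.
    by move=> [Ey nEy]; split=> // C'y; apply: nEy.
  by move=> [Ey nCy]; split=> // -[].
- exists (~` C); first exact: open_closedC.
  rewrite BC; apply/seteqP; split=> y.
    by move=> [Ey nEy]; split=> // Cy; apply: nEy.
  by move=> [Ey nCy]; split=> // -[].
Qed.

(** Linear independence, in the form met at a common point of two segments issued from the same
    end. *)
Definition noncollinear (R : pzRingType) (V : lmodType R) (u v : V) :=
  forall a b : R, a *: u = b *: v -> a = 0 /\ b = 0.

(** Off the line through [p] and [q] the determinant [det] is nonzero; from a point on the line,
    moving along the normal [n] changes it at the rate of the squared Euclidean length of
    [q - p]. *)
Lemma noncollinear_dense (R : realType) (p q : plane R) (U : set (plane R)) :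
  p <> q -> open U -> U !=set0 -> exists2 z, U z & noncollinear (p - z) (q - z).
Proof.
move=> pq oU [z0 Uz0].
pose det (z : plane R) := (p.1 - z.1) * (q.2 - z.2) - (p.2 - z.2) * (q.1 - z.1).
have detP z : det z != 0 -> noncollinear (p - z) (q - z).
  move=> dz a b abE.
  have E1 : a * (p.1 - z.1) = b * (q.1 - z.1) by exact: (congr1 fst abE).
  have E2 : a * (p.2 - z.2) = b * (q.2 - z.2) by exact: (congr1 snd abE).
  split; apply: (mulIf dz); rewrite mul0r /det.
    transitivity (a * (p.1 - z.1) * (q.2 - z.2) - a * (p.2 - z.2) * (q.1 - z.1)).
      by ring.
    by rewrite E1 E2; ring.
  transitivity ((p.1 - z.1) * (b * (q.2 - z.2)) - (p.2 - z.2) * (b * (q.1 - z.1))).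
    by ring.
  by rewrite -E1 -E2; ring.
have [d0|/detP] := eqVneq (det z0) 0; last by exists z0.
have [r r0 rU] := (open_normP U).1 oU z0 Uz0.
pose n : plane R := (p.2 - q.2, q.1 - p.1).
have n0 : 0 < `|n|.
  rewrite normr_gt0; apply/eqP => -[/subr0_eq p2 /subr0_eq p1].
  by apply: pq; case: (p) (q) p1 p2 => [p1 p2] [q1 q2] /= -> ->.
pose t := r / (2 * `|n|).
have t0 : 0 < t by rewrite divr_gt0// mulr_gt0.
exists (z0 + t *: n).
  apply: rU; rewrite opprD addNKr normrN normrZ gtr0_norm// /t invfM mulrA divfK ?gt_eqF//.
  by lra.
apply: detP.
have -> : det (z0 + t *: n) = det z0 + t * ((p.2 - q.2) ^+ 2 + (q.1 - p.1) ^+ 2).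
  rewrite /det (_ : (z0 + t *: n).1 = z0.1 + t * (p.2 - q.2))//.
  by rewrite (_ : (z0 + t *: n).2 = z0.2 + t * (q.1 - p.1))//; ring.
rewrite d0 add0r mulf_neq0//; first by rewrite gt_eqF.
rewrite paddr_eq0 ?sqr_ge0// !sqrf_eq0.
apply/negP => /andP[/eqP E2 /eqP E1].
by move: n0; rewrite /n E1 E2 normr0 ltxx.
Qed.

Section open_discrete.
Context {R : realType}.
Local Notation plane := (plane R).
Variables (Omega : set plane) (F : plane -> plane).
Hypotheses (oOmega : open Omega)
  (contF : forall x, Omega x -> {for x, continuous F})
  (openF : forall U : set plane, open U -> U `<=` Omega -> open (F @` U))
  (discF : forall x, Omega x -> exists2 r : R, 0 < r &
     forall y, Omega y -> `|x - y| < r -> F y = F x -> y = x).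

Let hV : hausdorff_space plane. Proof. exact: norm_hausdorff. Qed.

Let continuous_dist x r : Omega x -> 0 < r ->
  exists2 s, 0 < s & forall y, `|x - y| < s -> `|F x - F y| < r.
Proof.
move=> Ox r0; apply/(near_normP x (fun y => `|F x - F y| < r)).
exact: (contF Ox (nbhs_dist (F x) r0)).
Qed.

Let compact_image (K : set plane) : compact K -> K `<=` Omega -> compact (F @` K).
Proof.
move=> kK KO; apply: continuous_compact => //.
by apply: continuous_in_subspaceT => x /set_mem /KO; exact: contF.
Qed.

(** The bound [m] on the sphere keeps preimages of sets close to [F x] away from the boundary of the
    ball. *)
Definition isolating (x : plane) (s m : R) := [/\ 0 < s, 0 < m,
  [set y | `|x - y| <= s] `<=` Omega,
  forall y, `|x - y| <= s -> F y = F x -> y = x &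
  forall y, `|x - y| = s -> m <= `|F x - F y|].

Lemma isolating_exists x r : Omega x -> 0 < r ->
  exists s m, s <= r /\ isolating x s m.
Proof.
move=> Ox r0; have [d d0 dF] := discF Ox.
have [e e0 eO] := (open_normP Omega).1 oOmega x Ox.
pose s := Num.min r (Num.min (d / 2) (e / 2)).
have s0 : 0 < s by rewrite !lt_min r0 !divr_gt0.
have sO y : `|x - y| <= s -> Omega y.
  rewrite /s !le_min => /andP[_ /andP[_ xy]]; apply: eO; lra.
have sF y : `|x - y| <= s -> F y = F x -> y = x.
  move=> xy; have Oy := sO y xy; apply: dF => //.
  move: xy; rewrite /s !le_min => /andP[_ /andP[xy _]]; lra.
have cS : closed [set y : plane | `|x - y| = s].
  have cB := compact_closed hV (@plane_closed_ball_compact R x s).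
  rewrite (_ : [set _ | _] =
    [set y | `|x - y| <= s] `&` ~` [set y | `|x - y| < s]).
    by apply: closedI => //; exact/open_closedC/open_dist.
  apply/seteqP; split=> y /=; first by move=> ->; rewrite lexx ltxx.
  by move=> [yx /negP]; rewrite -leNgt => ?; apply/eqP; rewrite eq_le yx.
have kS : compact [set y : plane | `|x - y| = s].
  apply: subclosed_compact cS (@plane_closed_ball_compact R x s) _.
  by move=> y /= ->.
have SO : [set y : plane | `|x - y| = s] `<=` Omega by move=> y /= xy; apply: sO; rewrite xy.
have cFS := compact_closed hV (compact_image kS SO).
have [|m m0 mF] := closed_far (x := F x) cFS.
  move=> [y /= xy Fy]; have := sF y; rewrite xy lexx => /(_ isT Fy) yx.
  by move: s0; rewrite -xy yx subrr normr0 ltxx.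
exists s, m; split; first by rewrite /s ge_min lexx.
by split=> // y xy; apply: mF; exists y.
Qed.

(** No point of the sphere is mapped into [L], so the open and the closed ball give the same
    preimage; it is thus compact, and [preimage_connected] applies. *)
Lemma isolating_preimage x s m (L : set plane) : isolating x s m ->
  closed L -> connected L -> L (F x) -> (forall y, L y -> `|F x - y| < m) ->
  let E := [set y | `|x - y| < s] `&` F @^-1` L in compact E /\ connected E.
Proof.
move=> [s0 m0 sO sF mF] cL connL Lx Lm E.
have EE : E = [set y | `|x - y| <= s] `&` F @^-1` L.
  apply/seteqP; split=> y [/= xy Ly]; split=> //=; first exact: ltW.
  by rewrite lt_neqAle xy andbT; apply/eqP => /mF; have := Lm _ Ly; lra.
have kB := @plane_closed_ball_compact R x s.
have kE : compact E.
  apply: (subclosed_compact _ kB); last by rewrite EE => y [].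
  move=> y cy; rewrite EE.
  have xy : `|x - y| <= s.
    apply: (compact_closed hV kB); apply: closureS cy.
    by rewrite EE => z [].
  split=> //; apply: cL => B /(contF (sO _ xy)) FB.
  by have [z [[_ Lz] Bz]] := cy _ FB; exists (F z).
split=> //; apply: (preimage_connected hV connL Lx) => //.
- by rewrite /= subrr normr0.
- by move=> y /= /ltW; exact: sF.
- by move=> y /= /ltW xy; apply/contF/sO.
- exact: open_dist.
- move=> U oU Us; apply: openF => // y /Us /= /ltW; exact: sO.
Qed.

(* [E] and [E1] are lifts of the segments [F x0, z] and [z, F x] through the two
   preimages [x1], [x2] of [z]; they close up to a loop around a set [W] whose
   image is trapped in the union of the two segments. *)
Theorem locally_injective_punctured x0 : Omega x0 ->
  exists2 s, 0 < s & forall x, `|x0 - x| < s -> x <> x0 -> Omega x /\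
    exists2 r, 0 < r & forall x1 x2, `|x - x1| < r -> `|x - x2| < r ->
      F x1 = F x2 -> x1 = x2.
Proof.
move=> Ox0; have [s [m [_ iso0]]] := isolating_exists Ox0 ltr01.
have [s0 m0 sO sF mF] := iso0.
have [s' s'0 s'F] := continuous_dist Ox0 m0.
(* Points within [t] of [x0] have images within [m] of [F x0], so [iso0] will apply to the segment
   between [z] and [F x0]. *)
pose t := Num.min s s'.
have t0 : 0 < t by rewrite lt_min s0.
have ts x : `|x0 - x| < t -> `|x0 - x| < s by rewrite lt_min => /andP[].
have tF x : `|x0 - x| < t -> `|F x0 - F x| < m.
  by rewrite lt_min => /andP[_ /s'F].
exists t => // x xt xx0.
have Ox : Omega x by apply/sO/ltW/ts.
split=> //; apply: contrapT => noninj.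
have F0x : F x0 <> F x by move=> /esym /(sF _ (ltW (ts _ xt))).
have [|s1 [m1 [s1t iso1]]] := isolating_exists (r := t - `|x0 - x|) Ox.
  by rewrite subr_gt0.
have [s10 m10 s1O s1F m1F] := iso1.
have s1_t u : `|x - u| < s1 -> `|x0 - u| < t.
  move=> xu; have := ler_normD (x0 - x) (x - u); rewrite subrKA; lra.
have [r' r'0 r'F] := continuous_dist Ox m10.
pose r := Num.min s1 r'.
have r0 : 0 < r by rewrite lt_min s10.
have rs1 u : `|x - u| < r -> `|x - u| < s1 by rewrite lt_min => /andP[].
have rF u : `|x - u| < r -> `|F x - F u| < m1.
  by rewrite lt_min => /andP[_ /r'F].
have rO u : `|x - u| < r -> Omega u by move=> /rs1 /ltW; exact: s1O.
have [x1 [x2 [xx1 xx2 F12 x12]]] : exists x1 x2,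
    [/\ `|x - x1| < r, `|x - x2| < r, F x1 = F x2 & x1 <> x2].
  apply: contrapT => nex; apply: noninj; exists r => // x1 x2 xx1 xx2 F12.
  by apply: contrapT => x12; apply: nex; exists x1, x2.
have d12 : 0 < `|x1 - x2| / 2.
  by rewrite divr_gt0// normr_gt0 subr_eq0; apply/eqP.
(* Half the distance makes [N x1] and [N x2] disjoint, so the preimages of [z] chosen in them
   differ. *)
pose N y := [set u | `|x - u| < r] `&` [set u | `|y - u| < `|x1 - x2| / 2].
have oN y : open (N y) by apply: openI; exact: open_dist.
have NO y : N y `<=` Omega by move=> u [/rO].
have [||z [[y1 [xy1 xy1'] Fy1] [y2 [xy2 xy2'] Fy2]] zP] :=
    @noncollinear_dense R (F x0) (F x) (F @` N x1 `&` F @` N x2) F0x.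
- by apply: openI; apply: openF.
- by exists (F x1); split; [exists x1|exists x2]; rewrite // /N /= subrr normr0.
have y12 : y1 <> y2.
  move=> y12; move: xy1' xy2'; rewrite -y12 /= => h1 h2.
  have := ler_normD (x1 - y1) (y1 - x2); rewrite subrKA (distrC y1 x2); lra.
have [E_c E_conn] : let E := [set u | `|x0 - u| < s] `&` F @^-1` seg z (F x0) in
    compact E /\ connected E.
  apply: (isolating_preimage iso0); [|exact: connected_seg|exact: seg_right|].
    exact/(compact_closed hV)/compact_seg.
  apply: seg_ball; last by rewrite subrr normr0.
  by rewrite -Fy1; apply/tF/s1_t/rs1.
have [E1_c E1_conn] : let E := [set u | `|x - u| < s1] `&` F @^-1` seg z (F x) in
    compact E /\ connected E.
  apply: (isolating_preimage iso1); [|exact: connected_seg|exact: seg_right|].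
    exact/(compact_closed hV)/compact_seg.
  apply: seg_ball; last by rewrite subrr normr0.
  by rewrite -Fy1; exact: rF.
move: E_c E_conn E1_c E1_conn; set E := _ `&` _; set E1 := _ `&` _.
move=> E_c E_conn E1_c E1_conn.
have EE1z u : (E `&` E1) u -> F u = z.
  move=> [[_ [a _ aE]] [_ [b _ bE]]].
  have [|a0 _] := zP a b; first by apply: (addrI z); rewrite aE bE.
  by rewrite -aE a0 scale0r addr0.
have E_y u : N x1 u \/ N x2 u -> F u = z -> (E `&` E1) u.
  move=> Nu Fu; have xu : `|x - u| < r by case: Nu => -[].
  split; split=> /=; rewrite ?Fu; try exact: seg_left.
    exact/ts/s1_t/rs1.
  exact: rs1.
have [d d0 dF] := discF (rO y1 xy1).
have EE1_c : closed (E `&` E1) by apply: closedI; exact: compact_closed.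
(* The intersection splits into [y1], isolated in the fibre of [z], and a rest containing [y2]. *)
have [||||||W [oW [w Ww] [M WM] WEE1 clW]] := @janiszewski R E E1 [set y1]
   ((E `&` E1) `&` ~` [set u | `|y1 - u| < d]) E_c E1_c E_conn E1_conn.
- apply/seteqP; split=> u.
    move=> EE1u; have [y1u|] := pselect (`|y1 - u| < d); last by right.
    left; apply: dF => //; last by rewrite Fy1 EE1z.
    by case: EE1u => -[/= /ltW /sO].
  by case=> [-> | []//]; apply: E_y => //; left.
- exact/(compact_closed hV)/compact_set1.
- by apply: closedI => //; exact/open_closedC/open_dist.
- by apply/seteqP; split=> // u [-> [_]] /=; rewrite subrr normr0.
- by exists y1.
- exists y2; split; first by apply: E_y => //; right.
  move=> /= y1y2; apply: y12; apply/esym; apply: dF => //; first exact: rO.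
  by rewrite Fy1.
have EE1s : E `|` E1 `<=` [set u | `|x0 - u| < s].
  by move=> u [[]//|[/= /s1_t /ts]].
have Ws : W `<=` [set u | `|x0 - u| < s].
  apply: (star_shaped_fill (@star_shaped_ball _ _ x0 s s0) _ oW WM).
    by rewrite /= subrr normr0.
  by move=> u /clW[]; [left|right; exact: EE1s].
have WO : W `<=` Omega by move=> u /Ws /ltW /sO.
pose T := seg z (F x0) `|` seg z (F x).
have FT u : (E `|` E1) u -> T (F u).
  by move=> [[_ Lu]|[_ Lu]]; [left|right].
have kB := @plane_closed_ball_compact R x0 s.
have kFB := compact_image kB sO.
have [M' M'0 FM'] := compact_norm_le kFB.
have WB : W `<=` [set u | `|x0 - u| <= s] by move=> u /Ws /ltW.
have FWT : F @` W `<=` T.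
  apply: (@star_shaped_fill _ _ z T _ M').
  - by apply: star_shapedU; exact: star_shaped_seg.
  - by left; exact: seg_left.
  - exact: openF.
  - by move=> _ [u /WB xu <-]; apply: FM'; exists u.
  have clWB : closure W `<=` [set u | `|x0 - u| <= s].
    by move=> u /clW[/WB//|/EE1s /ltW].
  have kW : compact (closure W) by exact: (subclosed_compact (@closed_closure _ W) kB).
  have cFW := compact_closed hV (compact_image kW (subset_trans clWB sO)).
  move=> v; rewrite closureE => clv.
  have [u /clW[Wu|/FT Tu] <-] : (F @` closure W) v.
  - apply: clv; split=> // _ [u Wu <-]; exists u => //; exact: subset_closure.
  - by left; exists u.
  - by right.
have FWx u : W u -> seg z (F x) (F u).
  move=> Wu; have [|//] : T (F u) by apply: FWT; exists u.
  move=> zFu; have : (W `&` (E `|` E1)) u; last by rewrite WEE1.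
  split=> //; left; split; [exact: Ws|exact: zFu].
have [e e0 eFW] := (open_normP _).1 (openF oW WO) (F w) (imageP F Ww).
have n0 : 0 < `|F x0 - z|.
  rewrite normr_gt0; apply/eqP => Fz; have [|/eqP + _] := zP 1 0.
    by rewrite scale1r scale0r.
  by rewrite oner_eq0.
(* A move by [e / 2] in the direction [F x0 - z] stays in the image of [W], yet leaves the line
   carrying [seg z (F x)]. *)
pose a := e / (2 * `|F x0 - z|).
have a0 : 0 < a by rewrite divr_gt0// mulr_gt0.
have [|u Wu Fu] := eFW (F w + a *: (F x0 - z)).
  rewrite opprD addNKr normrN normrZ gtr0_norm// /a invfM mulrA divfK ?gt_eqF//.
  by lra.
have [[b _ bE] [b' _ b'E]] := (FWx w Ww, FWx u Wu).
have [|a00 _] := zP a (b' - b).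
  move: Fu; rewrite -bE -b'E -addrA => /addrI b'bE.
  by rewrite scalerBl b'bE addrAC subrr add0r.
by move: a0; rewrite a00 ltxx.
Qed.

End open_discrete.

(** * The complex plane *)

Lemma open_injective_local_homeo (X Y : topologicalType) (f : X -> Y) x
    (U : set X) : continuous f -> open_map f -> open U -> U x ->
  (forall v w, U v -> U w -> f v = f w -> v = w) -> local_homeo_at f x.
Proof.
move=> cf opf oU Ux injU; exists U; split=> //; first exact: opf.
(* Off the image of [U] the inverse takes the default value [x]; its continuity on the image comes
   from the openness of [f]. *)
have /choice[g gP] y : exists v, (f @` U) y -> U v /\ f v = y.
  have [[v Uv fv]|ny] := pselect ((f @` U) y); first by exists v.
  by exists x.
have gf v : U v -> g (f v) = v.
  by move=> Uv; have [] := gP (f v); [exists v|move=> ? ?; exact: injU].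
exists g; split; first exact: continuous_subspaceT.
- have ofU : open (f @` U) by exact: opf.
  rewrite continuous_open_subspace//.
  move=> _ /set_mem[v Uv <-] N; rewrite gf// => /= Nv.
  have : nbhs (f v) (f @` (U `&` N°)).
    apply: open_nbhs_nbhs; split; first by apply/opf/openI => //; exact: open_interior.
    by exists v => //; split=> //; exact: Nv.
  by apply: filterS => _ [w [Uw Nw] <-] /=; rewrite gf//; exact: interior_subset.
- by move=> v /set_mem; exact: gf.
Qed.

Lemma open_valL_continuous (X Y : topologicalType) (A : set X) (y0 : Y)
    (f : A -> Y) : open A -> continuous f ->
  forall x, A x -> {for x, continuous ('valL_(y0) f)}.
Proof.
move=> oA cf x Ax; have : {within A, continuous ('valL_(y0) f)}.
  exact/subspace_valL_continuousP'.
by rewrite continuous_open_subspace//; apply; exact: mem_set.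
Qed.

Section plane_complex.
Context {R : realType}.
Local Notation C := (Cplx R).
Local Notation plane := (plane R).

Definition to_complex (p : plane) : C := Complex p.1 p.2.
Definition of_complex (c : C) : plane := (complex.Re c, complex.Im c).

Lemma to_complexK : cancel to_complex of_complex.
Proof. by case. Qed.

Lemma of_complexK : cancel of_complex to_complex.
Proof. by case. Qed.

Lemma of_complex_norm (c : C) :
  `|of_complex c|%:C%C <= `|c : R[i]| /\ `|c : R[i]| <= (2 * `|of_complex c|)%:C%C.
Proof.
rewrite normc_def !lecR; split.
  by rewrite plane_norm_le /= -!sqrtr_sqr !ler_wsqrtr ?lerDl ?lerDr ?sqr_ge0.
set m := `|of_complex c|.
have : `|of_complex c| <= m by [].
rewrite plane_norm_le /= => /andP[am bm].
have m0 : 0 <= m by exact: normr_ge0.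
rewrite -[leRHS]ger0_norm ?mulr_ge0// -sqrtr_sqr ler_wsqrtr//.
have := lerD (lerXn2r 2 (normr_ge0 _) m0 am) (lerXn2r 2 (normr_ge0 _) m0 bm).
rewrite !real_normK ?num_real//; nra.
Qed.

Lemma of_complexB c d : of_complex (c - d) = of_complex c - of_complex d.
Proof. by case: c d => [? ?] [? ?]. Qed.

Lemma nbhs_complexP (c : C) (A : set C) : nbhs c A <->
  exists2 r : R, 0 < r & forall d, `|of_complex c - of_complex d| < r -> A d.
Proof.
apply: (iff_trans (@nbhs_normP R[i] C c A)); split=> [[r /= r0 rA]|[r r0 rA]].
  (* A positive element of [R[i]] is real. *)
  have [rE r1] : r = (complex.Re r)%:C%C /\ 0 < complex.Re r.
    move: r0; rewrite ltcE => /andP[/eqP r0 r1]; split=> //.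
    by apply/eqP; rewrite eq_complex /= eqxx; apply/eqP.
  exists (complex.Re r / 4) => [|d cd]; first by lra.
  apply: rA => /=; apply: le_lt_trans (of_complex_norm _).2 _.
  rewrite rE ltcR of_complexB; lra.
have r0' : 0 < r%:C%C :> R[i] by rewrite ltcR.
exists r%:C%C => [//|d /= cd].
apply: rA; rewrite -ltcR -of_complexB.
exact: le_lt_trans (of_complex_norm _).1 cd.
Qed.

Lemma of_complex_continuous : continuous of_complex.
Proof.
move=> c A /near_normP[r r0 rA]; apply/nbhs_complexP; exists r => // d.
exact: rA.
Qed.

Lemma to_complex_continuous : continuous to_complex.
Proof.
move=> p A /nbhs_complexP[r r0 rA].
apply: (@filterS _ (nbhs p) _ _ _ _ (nbhs_dist p r0)) => q pq.
by apply: rA; rewrite !to_complexK.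
Qed.

End plane_complex.

Theorem theorem1p2 (R : realType) (Omega : set (Cplx R)) (f : Omega -> Cplx R)
    (domain_Omega : domain Omega) (continuous_f : continuous f)
    (open_f : open_map f) (discrete_f : discrete_map f) :
  discrete_set (branch_set f).
Proof.
have [_ _ oOmega] := domain_Omega.
(* The map [f] is extended by 0; as [Omega] is open, the extension is continuous at each of its
   points. *)
pose G : Cplx R -> Cplx R := 'valL_(0 : Cplx R) f.
have GE (u : Omega) : G (set_val u) = f u.
  by rewrite /G -[in RHS](valLK (0 : Cplx R) f).
have inc_cont : continuous (set_val : Omega -> Cplx R) by exact: initial_continuous.
have G_cont := @open_valL_continuous _ _ Omega (0 : Cplx R) f oOmega continuous_f.
pose Omega' : set (plane R) := @to_complex R @^-1` Omega.
pose F : plane R -> plane R := (@of_complex R \o G) \o @to_complex R.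
pose pt (u : Omega) : plane R := of_complex (set_val u).
have pt_cont : continuous pt.
  by move=> u; apply: continuous_comp; [exact: inc_cont|exact: of_complex_continuous].
have ptO u : Omega' (pt u).
  by rewrite /Omega' /pt /= of_complexK; exact: set_valP.
have Opt p : Omega' p -> exists u, pt u = p.
  move=> Op; exists (exist _ (to_complex p) (mem_set Op)).
  by rewrite /pt /= to_complexK.
have FE u : F (pt u) = of_complex (f u).
  by rewrite /F /pt /= of_complexK GE.
have pt_inj : injective pt.
  by move=> u v /(can_inj (@of_complexK R))/val_inj.
have of_inj := can_inj (@of_complexK R).
have oO' : open Omega'.
  by apply: open_comp => // p _; exact: to_complex_continuous.
have F_cont p : Omega' p -> {for p, continuous F}.
  move=> Op; apply: (@continuous_comp (plane R) (Cplx R) (plane R)).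
    exact: to_complex_continuous.
  apply: (@continuous_comp (Cplx R) (Cplx R) (plane R)); first exact: G_cont.
  exact: of_complex_continuous.
have F_open (U : set (plane R)) : open U -> U `<=` Omega' -> open (F @` U).
  move=> oU UO.
  have -> : F @` U = @to_complex R @^-1` (f @` (pt @^-1` U)).
    apply/seteqP; split=> [_ [p Up <-]|p [u Uu fu]].
      have [u pu] := Opt _ (UO _ Up); exists u; first by rewrite /= pu.
      by rewrite -pu FE of_complexK.
    by exists (pt u) => //; rewrite FE fu to_complexK.
  apply: open_comp => [p _|]; first exact: to_complex_continuous.
  by apply: open_f; apply: open_comp => // u _; exact: pt_cont.
have F_disc p : Omega' p -> exists2 r, 0 < r &
    forall q, Omega' q -> `|p - q| < r -> F q = F p -> q = p.
  move=> /Opt[u <-].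
  have [_ [V Vu VE]] := discrete_f (f u) u erefl.
  have [_ [[W oW <-] /= Wu] WV] := Vu.
  have [r r0 rW] := (nbhs_complexP (set_val u) W).1 (open_nbhs_nbhs (conj oW Wu)).
  exists r => // _ /Opt[v <-] uv; rewrite !FE => /of_inj fvu.
  have : (V `&` f @^-1` [set f u]) v by split=> //; apply: WV; exact: rW.
  by rewrite VE => ->.
move=> x Bx.
(* Every other point of this ball has a neighbourhood on which [f] is injective, so it is no branch
   point. *)
have [s s0 sP] := locally_injective_punctured oO' F_cont F_open F_disc (ptO x).
have open_pt_ball (y : Omega) r : open [set u | `|pt y - pt u| < r].
  exact: (open_comp (fun u _ => pt_cont u) (open_dist (pt y) r)).
split; first exact: mem_set.
exists [set u | `|pt x - pt u| < s].
  by apply: open_nbhs_nbhs; split; [exact: open_pt_ball|rewrite /= subrr normr0].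
apply/seteqP; split=> [u [/= xu Bu]|_ -> /=]; last by rewrite subrr normr0.
apply: contrapT => ux; apply: Bu.
have [|_ [r r0 rP]] := sP (pt u) xu; first by move=> /pt_inj.
apply: (open_injective_local_homeo continuous_f open_f (open_pt_ball u r)).
  by rewrite /= subrr normr0.
by move=> v w uv uw fvw; apply/pt_inj/rP; rewrite ?FE ?fvw.
Qed.
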